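(* Let $p(z)=z^n+a_{n-1}z^{n-1}+\cdots+a_1z+a_0$ be a monic polynomial of degree $n\ge 2$ with coefficients $a_0,\dots,a_{n-1}\in\mathbb{C}$, let $C(p)$ be its Frobenius companion matrix, and let $\lambda$ be a zero of $p(z)$. Then $$|\lambda|\le w(C(p))\le\frac12\left[|a_{n-1}|+\cos\frac{\pi}{n}+\sqrt{\left(|a_{n-1}|-\cos\frac{\pi}{n}\right)^2+\sum_{r=0}^{n-2}|a_r|^2+1+\alpha}\right],$$ where $\alpha=|a_{n-2}|+\sqrt{\sum_{r=0}^{n-2}|a_r|^2}$.
   Context: The Frobenius companion matrix of $p$ is the $n\times n$ matrix $$C(p)=\begin{pmatrix}-a_{n-1}&-a_{n-2}&\cdots&-a_1&-a_0\\1&0&\cdots&0&0\\0&1&\cdots&0&0\\\vdots&\vdots&&\vdots&\vdots\\0&0&\cdots&1&0\end{pmatrix},$$ regarded as an operator on $\mathbb{C}^n$ with the usual inner product. The numerical radius of an operator $T$ on $\mathbb{C}^n$ is $w(T)=\sup\{|\langle Tx,x\rangle| : x\in\mathbb{C}^n,\ \|x\|=1\}$. *)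

(* Defs.v *)
From HB Require Import structures.
From mathcomp Require Import all_boot all_order all_algebra.
From mathcomp Require Import spectral.
From mathcomp Require Import complex.
From mathcomp Require Import all_classical all_reals all_analysis.

Set Implicit Arguments.
Unset Strict Implicit.
Unset Printing Implicit Defensive.

Import Order.TTheory GRing.Theory Num.Theory.
Import ComplexField.Normc.

Local Open Scope classical_set_scope.
Local Open Scope ring_scope.
Local Open Scope complex_scope.

(* First row -a_(n-1), ..., -a_0, ones on the subdiagonal.  This is not
   mxpoly.companionmx, which has the coefficients in its last row. *)
Definition frobenius_companion (K : nzRingType) (n : nat) (p : {poly K}) :
    'M[K]_n :=
  \matrix_(i < n, j < n)
    if (i == 0 :> nat) then - p`_(n.-1 - j) else (i == j.+1 :> nat)%:R.

(* dotmx is defined on row vectors, while operators act on columns here. *)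
Definition cinner (K : numClosedFieldType) (n : nat) (x y : 'cV[K]_n) : K :=
  dotmx x^T y^T.

Definition cnorm (K : numClosedFieldType) (n : nat) (x : 'cV[K]_n) : K :=
  sqrtC (cinner x x).

(* The modulus is taken in R (normc) rather than in R[i] (`|_|), since sup is
   the supremum in R.  The set is bounded above, and nonempty for 0 < n; the
   value for n = 0 is sup set0 = 0. *)
Definition numerical_radius (R : realType) (n : nat) (T : 'M[R[i]]_n) : R :=
  sup [set normc (cinner (T *m x) x) | x in [set x : 'cV[R[i]]_n | cnorm x = 1]].

(* Main.v *)
Require Import Defs.
From HB Require Import structures.
From mathcomp Require Import all_boot all_order all_algebra.
From mathcomp Require Import spectral.
From mathcomp Require Import complex.
From mathcomp Require Import all_classical all_reals all_analysis.
From mathcomp Require Import ring lra.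

Set Implicit Arguments.
Unset Strict Implicit.
Unset Printing Implicit Defensive.

Import Order.TTheory GRing.Theory Num.Theory.
Import ComplexField.Normc.

Local Open Scope ring_scope.
Local Open Scope complex_scope.

(** The lower bound is the general fact that eigenvalues lie in the numerical
    range: a zero l of p is an eigenvalue of C(p), with eigenvector
    (l^(n-1), ..., l, 1), by [companion_eigenvector].

    For the upper bound, pass to the moduli t_k = |x_k|.  The triangle
    inequality bounds |<C(p)x, x>| by the real quadratic form
      |a_(n-1)| t_0^2 + t_0 (sum_(j >= 1) b_j t_j) + sum_(k >= 1) t_k t_(k+1),
    where the border is b_j = |a_(n-1-j)|, except that b_1 = |a_(n-2)| + 1
    absorbs the first subdiagonal entry ([companion_form_le]).  The last sum is
    the form of a shift on n-1 coordinates, so it is at most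
    cos(pi/n) sum_(k >= 1) t_k^2 ([shift_form_le_cos]).  What remains is the
    largest eigenvalue of the 2 x 2 symmetric matrix with diagonal
    |a_(n-1)|, cos(pi/n) and off-diagonal entry |b|/2 ([bordered_form_le]),
    namely half of
      |a_(n-1)| + cos(pi/n) + sqrt((|a_(n-1)| - cos(pi/n))^2 + |b|^2).
    Finally |b|^2 = sum_(r <= n-2) |a_r|^2 + 1 + 2 |a_(n-2)|, and the second
    copy of |a_(n-2)| is at most the Euclidean norm of (a_0, ..., a_(n-2));
    this is where alpha comes from ([companion_border_sum_le]). *)

(** * Eigenvalues and the numerical radius *)

Lemma normc_ge0 (R : rcfType) (z : R[i]) : 0 <= normc z.
Proof. by case: z => a b; apply: sqrtr_ge0. Qed.

Lemma normc_conj (R : rcfType) (z : R[i]) : normc (Num.conj z) = normc z.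
Proof. by case: z => a b /=; rewrite sqrrN. Qed.

Lemma normc_sum (R : rcfType) (I : Type) (r : seq I) (F : I -> R[i]) :
  normc (\sum_(i <- r) F i) <= \sum_(i <- r) normc (F i).
Proof.
elim/big_ind2: _ => [|x1 x2 y1 y2 le1 le2|//]; first by rewrite normc0.
by apply: (le_trans (le_normcD _ _)); apply: lerD.
Qed.

Lemma mulc_conj (R : rcfType) (z : R[i]) :
  z * Num.conj z = (normc z ^+ 2)%:C.
Proof. by rewrite -normCK rmorphXn. Qed.

Lemma cinnerE (K : numClosedFieldType) (n : nat) (x y : 'cV[K]_n) :
  cinner x y = \sum_(i < n) x i 0 * Num.conj (y i 0).
Proof.
by rewrite /cinner dotmxE mxE; apply: eq_bigr => i _; rewrite !mxE.
Qed.

Lemma cinner_self (R : rcfType) (n : nat) (x : 'cV[R[i]]_n) :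
  cinner x x = (\sum_(i < n) normc (x i 0) ^+ 2)%:C.
Proof.
rewrite cinnerE rmorph_sum; apply: eq_bigr => i _; exact: mulc_conj.
Qed.

Lemma cnorm_eq1 (R : rcfType) (n : nat) (x : 'cV[R[i]]_n) :
  cnorm x = 1 <-> \sum_(i < n) normc (x i 0) ^+ 2 = 1.
Proof.
rewrite /cnorm cinner_self; split => [h|->]; last by rewrite rmorph1 sqrtC1.
apply: complexI; rewrite rmorph1.
by rewrite -[LHS]sqrtCK h expr1n.
Qed.

(** The supremum of an unbounded set of reals has a junk value, so even the lower
    bound needs the numerical range to be bounded, and the upper bound needs it
    to be nonempty.  The quadratic bound mu provides the former and the
    normalised eigenvector the latter, hence one lemma for both estimates. *)
Lemma numerical_radius_eigen_bounds (R : realType) (n : nat)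
    (T : 'M[R[i]]_n) (v : 'cV[R[i]]_n) (lambda : R[i]) (mu : R) :
    v != 0 -> T *m v = lambda *: v ->
    (forall x : 'cV[R[i]]_n,
       normc (cinner (T *m x) x) <= mu * \sum_(i < n) normc (x i 0) ^+ 2) ->
  normc lambda <= numerical_radius T /\ numerical_radius T <= mu.
Proof.
move=> v0 Tv mub.
set N : R := \sum_(i < n) normc (v i 0) ^+ 2.
have N0 : 0 < N.
  rewrite lt_def sumr_ge0 ?andbT => [|i _]; last by rewrite exprn_ge0 ?normc_ge0.
  apply: contra v0 => /eqP N0; apply/eqP/matrixP => i j; rewrite ord1 mxE.
  apply: eq0_normc; apply/eqP; rewrite -sqrf_eq0.
  by rewrite (psumr_eq0P _ N0) // => k _; rewrite exprn_ge0 ?normc_ge0.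
pose u : 'cV[R[i]]_n := (Num.sqrt N)^-1%:C *: v.
have u1 : \sum_(i < n) normc (u i 0) ^+ 2 = 1.
  under eq_bigr do rewrite mxE normcM exprMn.
  rewrite -mulr_sumr -/N /= expr0n addr0 sqrtr_sqr normfV.
  by rewrite ger0_norm ?sqrtr_ge0// exprVn sqr_sqrtr ?ltW// mulVf ?gt_eqF.
have Tu : normc (cinner (T *m u) u) = normc lambda.
  have -> : T *m u = lambda *: u by rewrite -scalemxAr Tv !scalerA mulrC.
  rewrite cinnerE; under eq_bigr do rewrite mxE -mulrA.
  by rewrite -mulr_sumr -cinnerE cinner_self u1 normcM normc1 mulr1.
have ub : ubound [set normc (cinner (T *m x) x) | x in
                   [set x : 'cV[R[i]]_n | cnorm x = 1]]%classic mu.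
  by move=> _ [x /cnorm_eq1 x1 <-]; rewrite (le_trans (mub x)) // x1 mulr1.
have inu : [set normc (cinner (T *m x) x) | x in
                   [set x : 'cV[R[i]]_n | cnorm x = 1]]%classic (normc lambda).
  by exists u => //; apply/cnorm_eq1.
split; last by apply: ge_sup => //; exists (normc lambda).
by apply: ub_le_sup => //; exists mu.
Qed.

(** * Two real quadratic forms *)

(** This is Perron-Frobenius for a path: a positive s solving the eigenvector
    equation s_(k-1) + s_(k+1) = 2 c s_k, with s_0 = s_(m+2) = 0, makes c the
    largest eigenvalue of half the adjacency matrix.  Each edge is split by
    2 t_k t_(k+1) <= q t_k^2 + q^-1 t_(k+1)^2 with q = s_(k+2) / s_(k+1); the
    two weights received by a vertex then add up to 2 c. *)
Lemma path_form_le (R : realFieldType) (m : nat) (c : R) (s t : nat -> R) :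
    s 0%N = 0 -> (forall k, s k.+2 = 2 * c * s k.+1 - s k) ->
    (forall k, (k <= m)%N -> 0 < s k.+1) -> s m.+2 = 0 ->
  \sum_(k < m) t k * t k.+1 <= c * \sum_(k < m.+1) t k ^+ 2.
Proof.
move=> s0 srec spos send.
(* The weight that vertex j would receive from its right edge is kept on the
   left-hand side; it vanishes at the end of the path. *)
have key j : (j <= m)%N ->
    2 * \sum_(k < j) t k * t k.+1 + s j.+2 / s j.+1 * t j ^+ 2 <=
    2 * c * \sum_(k < j.+1) t k ^+ 2.
  elim: j => [|j IHj] jm.
    rewrite big_ord0 big_ord_recr big_ord0 /= srec s0 subr0 mulfK ?gt_eqF ?spos//.
    by rewrite mulr0 !add0r.
  rewrite big_ord_recr [X in _ <= _ * X]big_ord_recr /=.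
  have /IHj := ltnW jm; have p1 := spos _ (ltnW jm); have p2 := spos _ jm.
  set q := s j.+2 / s j.+1; have q0 : 0 < q by rewrite divr_gt0.
  have -> : s j.+3 / s j.+2 = 2 * c - q^-1.
    by rewrite srec /q invf_div mulrBl mulfK ?gt_eqF.
  have amgm : 2 * (t j * t j.+1) <= q * t j ^+ 2 + q^-1 * t j.+1 ^+ 2.
    rewrite -subr_ge0.
    have -> : q * t j ^+ 2 + q^-1 * t j.+1 ^+ 2 - 2 * (t j * t j.+1)
            = q * (t j - q^-1 * t j.+1) ^+ 2 by field; rewrite gt_eqF.
    by rewrite mulr_ge0 ?sqr_ge0 ?ltW.
  by lra.
have := key m (leqnn m); rewrite send mul0r mul0r addr0 -mulrA.
by rewrite ler_pM2l.
Qed.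

(** The shift on m+1 coordinates has numerical radius cos(pi/(m+2)); the Perron
    vector of its real part is sin(k pi/(m+2)), k = 1, ..., m+1. *)
Lemma shift_form_le_cos (R : realType) (m : nat) (t : nat -> R) :
  \sum_(k < m) t k * t k.+1 <= cos (pi / m.+2%:R) * \sum_(k < m.+1) t k ^+ 2.
Proof.
set h : R := pi / m.+2%:R.
apply: (@path_form_le _ _ _ (fun k => sin (h *+ k))).
- by rewrite mulr0n sin0.
- move=> k; have -> : h *+ k.+2 = h *+ k.+1 + h by rewrite mulrSr.
  have -> : h *+ k = h *+ k.+1 - h by rewrite mulrSr addrK.
  by rewrite sinD sinB; ring.
- move=> k km; apply: sin_gt0_pi; rewrite -mulr_natr /h; apply/andP; split.
    by rewrite mulr_gt0 ?divr_gt0 ?pi_gt0.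
  rewrite -mulrA gtr_pMr ?pi_gt0// mulrC ltr_pdivrMr// mul1r ltr_nat.
  by rewrite !ltnS.
- by rewrite -mulr_natr /h mulfVK ?pnatr_eq0// sinpi.
Qed.

(** With d = mu - c > 0, completing the square in each t_j gives
    s b_j t_j <= b_j^2 s^2 / (4 d) + d t_j^2; summing, the coefficient of s^2 is
    at most mu - A exactly when the hypothesis on |b|^2 holds.  So it suffices
    that mu dominates the 2 x 2 matrix with diagonal A, c and off-diagonal
    entry |b|/2. *)
Lemma bordered_form_le (R : realFieldType) (m : nat) (A c mu s : R)
    (b t : nat -> R) :
    c < mu -> \sum_(j < m) b j ^+ 2 <= 4 * (mu - A) * (mu - c) ->
  A * s ^+ 2 + s * \sum_(j < m) b j * t j + c * \sum_(j < m) t j ^+ 2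
    <= mu * (s ^+ 2 + \sum_(j < m) t j ^+ 2).
Proof.
rewrite -subr_gt0 => d0; set d := mu - c in d0 * => hb.
set B := \sum_(j < m) b j ^+ 2 in hb.
set U := \sum_(j < m) t j ^+ 2; set V := \sum_(j < m) b j * t j.
have amgm : s * V <= (4 * d)^-1 * s ^+ 2 * B + d * U.
  rewrite !mulr_sumr -big_split /=; apply: ler_sum => j _; rewrite -subr_ge0.
  have -> : (4 * d)^-1 * s ^+ 2 * b j ^+ 2 + d * t j ^+ 2 - s * (b j * t j)
          = (4 * d)^-1 * (s * b j - 2 * d * t j) ^+ 2 by field; rewrite gt_eqF.
  by rewrite mulr_ge0 ?sqr_ge0 ?invr_ge0 ?mulr_ge0 ?ltW.
have hs : (4 * d)^-1 * s ^+ 2 * B <= (mu - A) * s ^+ 2.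
  rewrite mulrAC ler_wpM2r ?sqr_ge0// mulrC ler_pdivrMr ?mulr_gt0//.
  by rewrite mulrCA mulrA.
have -> : mu * (s ^+ 2 + U) = A * s ^+ 2 + (mu - A) * s ^+ 2 + c * U + d * U.
  by rewrite /d; ring.
by lra.
Qed.

(** * The Frobenius companion matrix *)

(** The equation p(l) = 0 gives the first coordinate, l^n = - sum_(k < n) p_k l^k;
    the other rows only shift the powers of l. *)
Lemma companion_eigenvector (K : fieldType) (n : nat) (p : {poly K}) (l : K) :
    p \is monic -> size p = n.+1 -> root p l ->
  frobenius_companion n p *m (\col_(i < n) l ^+ (n.-1 - i))
    = l *: \col_(i < n) l ^+ (n.-1 - i).
Proof.
move=> pm ps /rootP pl; apply/matrixP => i j; rewrite !mxE.
case: n i ps => [[]//|n] i ps.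
under eq_bigr do rewrite !mxE.
case: (posnP i) => [-> /=|i0].
  rewrite (reindex_inj rev_ord_inj) /= subn0 -exprS.
  move: pl; rewrite horner_coef ps big_ord_recr /=.
  have -> : p`_n.+1 = 1 by rewrite -(monicP pm) lead_coefE ps.
  rewrite mul1r addrC => /eqP; rewrite addr_eq0 => /eqP ->.
  rewrite -sumrN; apply: eq_bigr => k _; rewrite subSS subKn ?mulNr//.
  by rewrite -ltnS.
have ipn : (i.-1 < n.+1)%N by rewrite prednK // ltnW.
rewrite (bigD1 (Ordinal ipn)) //= prednK // eqxx mul1r.
rewrite big1 ?addr0 => [|k].
  rewrite -exprS; congr (_ ^+ _); rewrite -subSn; last by rewrite -ltnS.
  by rewrite -[in RHS](prednK i0) subSS.
move=> /negPf kn; rewrite -(prednK i0) eqSS.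
suff -> : (i.-1 == k :> nat) = false by rewrite mul0r.
by move: kn; rewrite -val_eqE /= eq_sym.
Qed.

(** The coordinate x_0 meets the matrix twice, through the first row and through
    the first subdiagonal entry.  The contribution t_0 t_1 of the latter is
    moved into the border, which leaves a pure shift form on the other
    coordinates. *)
Lemma companion_form_le (R : rcfType) (m : nat) (p : {poly R[i]})
    (x : 'cV[R[i]]_m.+2) (t : nat -> R) :
    (forall i : 'I_m.+2, t i = normc (x i 0)) ->
  normc (cinner (frobenius_companion m.+2 p *m x) x) <=
    normc p`_m.+1 * t 0%N ^+ 2
    + t 0%N * \sum_(j < m.+1) (normc p`_(m - j) + (j == 0 :> nat)%:R) * t j.+1
    + \sum_(k < m) t k.+1 * t k.+2.
Proof.
move=> tE; have t_ge0 (i : 'I_m.+2) : 0 <= t i by rewrite tE normc_ge0.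
rewrite cinnerE big_ord_recl.
have row0 : normc ((frobenius_companion m.+2 p *m x) ord0 0) <=
    normc p`_m.+1 * t 0%N + \sum_(j < m.+1) normc p`_(m - j) * t j.+1.
  rewrite mxE; apply: (le_trans (normc_sum _ _)); rewrite big_ord_recl.
  apply: lerD; first by rewrite mxE /= subn0 normcM normcN -tE.
  by apply: ler_sum => j _; rewrite mxE /= normcM normcN -tE subSS.
have rowS (i : 'I_m.+1) : (frobenius_companion m.+2 p *m x) (lift ord0 i) 0
    = x (widen_ord (leqnSn _) i) 0.
  rewrite mxE (bigD1 (widen_ord (leqnSn _) i)) //= mxE /= eqxx mul1r.
  rewrite big1 ?addr0 // => k; rewrite -val_eqE /= mxE /= eqSS => /negPf.
  by rewrite eq_sym => ->; rewrite mul0r.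
under eq_bigr do rewrite rowS.
apply: (le_trans (le_normcD _ _)); rewrite normcM normc_conj -tE /=.
apply: (@le_trans _ _ ((normc p`_m.+1 * t 0%N +
    \sum_(j < m.+1) normc p`_(m - j) * t j.+1) * t 0%N
    + \sum_(k < m.+1) t k * t k.+1)).
  apply: lerD; first by rewrite ler_wpM2r // (t_ge0 ord0).
  apply: (le_trans (normc_sum _ _)); apply: ler_sum => k _.
  by rewrite normcM normc_conj -!tE.
rewrite [X in _ + X <= _]big_ord_recl /=.
under [X in _ <= _ + _ * X + _]eq_bigr do rewrite mulrDl.
rewrite big_split /= [X in _ <= _ + _ * (_ + X) + _]big_ord_recl /=.
rewrite [X in _ <= _ + _ * (_ + (_ + X)) + _]big1 => [|j _]; last by rewrite mul0r.
by rewrite le_eqVlt; apply/orP; left; apply/eqP; ring.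
Qed.

(** Expanding the square at j = 0 gives S + 1 + 2 a_m, where a_m <= sqrt S since
    a_m^2 is one of the terms of S. *)
Lemma companion_border_sum_le (R : rcfType) (m : nat) (a : nat -> R) :
  \sum_(j < m.+1) (a (m - j)%N + (j == 0 :> nat)%:R) ^+ 2
    <= \sum_(0 <= r < m.+1) a r ^+ 2 + 1
       + (a m + Num.sqrt (\sum_(0 <= r < m.+1) a r ^+ 2)).
Proof.
set S := \sum_(0 <= r < _) _.
have -> : \sum_(j < m.+1) (a (m - j)%N + (j == 0 :> nat)%:R) ^+ 2
        = S + 1 + (a m + a m).
  have -> : S = \sum_(j < m.+1) a (m - j)%N ^+ 2.
    rewrite /S big_mkord (reindex_inj rev_ord_inj) /=.
    by apply: eq_bigr => j _; rewrite subSS.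
  rewrite !big_ord_recl /= subn0.
  under eq_bigr do rewrite addr0.
  by ring.
rewrite lerD2l lerD2l; apply: le_trans (ler_norm _) _.
rewrite -sqrtr_sqr ler_wsqrtr // /S big_nat_recr //= lerDr.
by apply: sumr_ge0 => r _; apply: sqr_ge0.
Qed.

Theorem theorem3p3 (R : realType) (n : nat) (p : {poly R[i]}) (lambda : R[i])
    (hn : (2 <= n)%N) (p_monic : p \is monic) (p_deg : size p = n.+1)
    (hlambda : root p lambda) :
  let a (r : nat) : R := normc p`_r in
  let S : R := \sum_(0 <= r < n.-1) a r ^+ 2 in
  let alpha : R := a (n - 2)%N + Num.sqrt S in
  let c : R := cos (pi / n%:R) in
  normc lambda <= numerical_radius (frobenius_companion n p) /\
  numerical_radius (frobenius_companion n p) <=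
    2^-1 * (a (n - 1)%N + c +
            Num.sqrt ((a (n - 1)%N - c) ^+ 2 + S + 1 + alpha)).
Proof.
move=> a S alpha c.
have ev := companion_eigenvector p_monic p_deg hlambda.
case: n hn p_deg @S @alpha @c ev => [|[|m]] // _ _ S alpha c ev.
apply: numerical_radius_eigen_bounds ev _ => [|x].
  apply/eqP => /matrixP/(_ ord_max 0); rewrite !mxE /= subnn expr0.
  by move/eqP; rewrite oner_eq0.
set W := (_ + alpha); set mu := 2^-1 * _.
pose t k := normc (x (inord k) 0).
have tE (i : 'I_m.+2) : t i = normc (x i 0) by rewrite /t inord_val.
have alpha_ge0 : 0 <= alpha by rewrite /alpha addr_ge0 ?normc_ge0 ?sqrtr_ge0.
have S_ge0 : 0 <= S by apply: sumr_ge0 => r _; apply: sqr_ge0.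
have W_gt : (a (m.+2 - 1)%N - c) ^+ 2 < W by rewrite /W; lra.
have W_ge0 : 0 <= W by rewrite (le_trans _ (ltW W_gt)) ?sqr_ge0.
have cmu : c < mu.
  have : `|a (m.+2 - 1)%N - c| < Num.sqrt W.
    by rewrite -sqrtr_sqr ltr_sqrt // (le_lt_trans _ W_gt) ?sqr_ge0.
  by rewrite ltr_norml /mu => /andP[]; lra.
(* mu is the larger root of 4 (mu - a_(m+1)) (mu - c) = S + 1 + alpha. *)
have hb : \sum_(j < m.+1) (a (m - j)%N + (j == 0 :> nat)%:R) ^+ 2
    <= 4 * (mu - a m.+1) * (mu - c).
  have -> : 4 * (mu - a m.+1) * (mu - c)
      = Num.sqrt W ^+ 2 - (a m.+1 - c) ^+ 2 by rewrite /mu subn1 /=; field.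
  rewrite sqr_sqrtr //.
  suff -> : W - (a m.+1 - c) ^+ 2 = S + 1 + alpha.
    by rewrite /alpha subSS subSS subn0; apply: companion_border_sum_le.
  by rewrite /W subn1 /=; ring.
apply: le_trans (companion_form_le p tE) _.
under [X in _ <= _ * X]eq_bigr do rewrite -tE.
rewrite [X in _ <= _ * X]big_ord_recl /=.
apply: le_trans (@bordered_form_le _ _ _ _ _ (t 0%N)
  (fun j => a (m - j)%N + (j == 0)%:R) (fun j => t j.+1) cmu hb).
by apply: lerD => //; exact: (shift_form_le_cos m (fun k => t k.+1)).
Qed.
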